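(* For any finite normal subgroup $N$ of a group $G$ of bounded exponent, there exists a characteristic finite subgroup $H$ of $G$ such that the spectrum of $G/H$ is contained in the spectrum of $G/N$.
   Context: The spectrum of a group is the set of orders of all its elements. A group has bounded exponent if there is a positive integer $m$ with $g^m=1$ for all elements $g$. *)

(* Defs.v *)
From HB Require Import structures.
From mathcomp Require Import all_boot.
From mathcomp Require Import boolp classical_sets cardinality.

Set Implicit Arguments.
Unset Strict Implicit.
Unset Printing Implicit Defensive.

Local Open Scope group_scope.
Local Open Scope quotient_scope.
Local Open Scope classical_set_scope.

(* Subgroups of a possibly infinite [groupType] are [groupClosed] predicates.
   Finite subsets of a [groupType] are always decidable, so using boolean
   predicates excludes no finite subgroup. *)

HB.mixin Record isNormalClosed (G : groupType) (S : {pred G}) := {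
  gpredJ : forall x y : G, x \in S -> x ^ y \in S
}.

#[short(type="normalClosed")]
HB.structure Definition NormalClosed (G : groupType) :=
  {S of GroupClosed G S & isNormalClosed G S}.

Section QuotientGroup.

Variables (G : groupType) (N : normalClosed G).
Implicit Types x y z : G.

Definition coset_eq x y := x^-1 * y \in N.

Lemma coset_eq_is_equiv : equiv_class_of coset_eq.
Proof.
rewrite /coset_eq; split=> [x|x y|y x z].
- by rewrite mulVg gpred1.
- by rewrite -gpredV invgM invgK.
- move=> xy yz; have -> : x^-1 * z = (x^-1 * y) * (y^-1 * z).
    by rewrite -!mulgA mulVKg.
  exact: gpredM.
Qed.

Canonical coset_eq_equiv := EquivRelPack coset_eq_is_equiv.
Canonical coset_eq_encModRel := defaultEncModRel coset_eq.

Definition quotg := {eq_quot coset_eq}.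

HB.instance Definition _ : EqQuotient G coset_eq quotg := EqQuotient.on quotg.
HB.instance Definition _ := Choice.on quotg.

Definition oneq : quotg := lift_cst quotg 1.
Definition mulq := lift_op2 quotg *%g.
Definition invq := lift_op1 quotg inv.

Canonical pi_oneq_morph := PiConst oneq.

Lemma pi_coset_eq x y : (x == y %[mod quotg]) = coset_eq x y.
Proof. by rewrite piE. Qed.

Lemma coset_eq_repr x : coset_eq x (repr (\pi_quotg x)).
Proof. by rewrite -pi_coset_eq reprK. Qed.

Lemma pi_invq : {morph \pi_quotg : x / x^-1 >-> invq x}.
Proof.
move=> x; unlock invq; apply/eqP; rewrite pi_coset_eq /coset_eq.
have := coset_eq_repr x; rewrite /coset_eq; set y := repr _ => Nxy.
rewrite -gpredV invgM !invgK.
have -> : y * x^-1 = (x^-1 * y) ^ x^-1 by rewrite /conjg invgK !mulgA mulgV mul1g.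
exact: gpredJ.
Qed.
Canonical pi_invq_morph := PiMorph1 pi_invq.

Lemma pi_mulq : {morph \pi_quotg : x y / x * y >-> mulq x y}.
Proof.
move=> x y; unlock mulq; apply/eqP; rewrite pi_coset_eq /coset_eq.
have := coset_eq_repr x; have := coset_eq_repr y; rewrite /coset_eq.
set u := repr _; set v := repr _ => Nyu Nxv.
have -> : (x * y)^-1 * (v * u) = (x^-1 * v) ^ y * (y^-1 * u).
  by rewrite /conjg invgM -!mulgA mulVKg.
by rewrite gpredM// gpredJ.
Qed.
Canonical pi_mulq_morph := PiMorph2 pi_mulq.

Lemma mulqA : associative mulq.
Proof. by move=> x y z; rewrite -[x]reprK -[y]reprK -[z]reprK !piE mulgA. Qed.

Lemma mul1q : left_id oneq mulq.
Proof. by move=> x; rewrite -[x]reprK !piE mul1g. Qed.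

Lemma mulq1 : right_id oneq mulq.
Proof. by move=> x; rewrite -[x]reprK !piE mulg1. Qed.

Lemma mulVq : left_inverse oneq invq mulq.
Proof. by move=> x; rewrite -[x]reprK !piE mulVg. Qed.

Lemma mulqV : right_inverse oneq invq mulq.
Proof. by move=> x; rewrite -[x]reprK !piE mulgV. Qed.

HB.instance Definition _ := isGroup.Build quotg mulqA mul1q mulq1 mulVq mulqV.

Lemma pi_quotgM : {morph \pi_quotg : x y / x * y >-> x * y}.
Proof. exact: pi_mulq. Qed.

Lemma pi_quotg1 : \pi_quotg 1 = 1.
Proof. by rewrite -[RHS]/oneq; unlock oneq. Qed.

HB.instance Definition _ :=
  isUMagmaMorphism.Build G quotg \pi_quotg (pi_quotg1, pi_quotgM).

End QuotientGroup.

Definition bounded_exponent (G : groupType) : Prop :=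
  exists2 m : nat, (0 < m)%N & forall g : G, g ^+ m = 1.

Definition has_order (G : groupType) (x : G) (n : nat) : Prop :=
  [/\ (0 < n)%N, x ^+ n = 1 & forall m, (0 < m)%N -> x ^+ m = 1 -> (n <= m)%N].

(* An element of infinite order contributes nothing here; there is none in a
   group of bounded exponent or in a quotient of such a group. *)
Definition spectrum (G : groupType) : set nat :=
  [set n | exists x : G, has_order x n].

Definition characteristic (G : groupType) (H : groupClosed G) : Prop :=
  forall f : {multiplicative G -> G}, bijective f -> f @` [set` H] = [set` H].

(* Main.v *)
(** Say that a relation R(M_1, ..., M_k) between finite normal subgroups, which
    is monotone, is multilinear if it is preserved by intersections in each
    argument separately.  If n_1, ..., n_k are the orders of the elements of
    G/N, then "every x has some x^(n_i) in M_i" is such a relation, and it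
    holds at (N, ..., N).  The arguments can be made characteristic one at a
    time: if R(D, K, ..., K) holds with D of minimal size, then for every
    automorphism f it also holds at (D :&: f^-1 D, K f^-1(K), ..., K f^-1(K)),
    so D lies in f^-1 D.  Once the first argument D is characteristic, the
    relation R(D, -, ..., -) is again invariant under automorphisms, and one
    proceeds with K.  The product H of the characteristic subgroups thus
    obtained satisfies R(H, ..., H), so every order in G/H divides some n_i, and
    the spectrum of G/N is closed under divisors. *)
Require Import Defs.
From HB Require Import structures.
From mathcomp Require Import all_boot finmap.
From mathcomp Require Import boolp classical_sets cardinality.

Local Open Scope classical_set_scope.

Section NormalSubgroups.
Set Implicit Arguments.
Unset Strict Implicit.
Local Open Scope group_scope.

Context {G : groupType}.
Implicit Types (A B : normalClosed G) (x y : G).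

Lemma gpredJE A x y : (x ^ y \in A) = (x \in A).
Proof.
by apply/idP/idP => [/(Defs.gpredJ _ y^-1)|/Defs.gpredJ//]; rewrite -conjgM mulgV conjg1.
Qed.

Definition pack_normalClosed (S : {pred G}) (S1 : 1 \in S)
    (SM : mulg_closed S) (SV : invg_closed S)
    (SJ : forall x y, x \in S -> x ^ y \in S) : normalClosed G :=
  HB.pack S (isMul1Closed.Build G S S1) (isMulClosed.Build G S SM)
    (isInvClosed.Build G S SV) (isNormalClosed.Build G S SJ).

Definition trivial_subgroup : normalClosed G.
Proof.
apply: (@pack_normalClosed [pred x | x == 1]).
- by rewrite inE.
- by move=> x y; rewrite !inE => /eqP-> /eqP->; rewrite mulg1.
- by move=> x; rewrite !inE => /eqP->; rewrite invg1.
- by move=> x y; rewrite !inE => /eqP->; rewrite conj1g.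
Defined.

Lemma mem_trivial_subgroup x : (x \in trivial_subgroup) = (x == 1).
Proof. by []. Qed.

Lemma finite_trivial_subgroup : finite_set [set` trivial_subgroup].
Proof. by apply: sub_finite_set (finite_set1 (1 : G)) => x /eqP. Qed.

Definition meet_subgroup A B : normalClosed G.
Proof.
apply: (@pack_normalClosed [pred x | (x \in A) && (x \in B)]).
- by rewrite inE !gpred1.
- by move=> x y; rewrite !inE => /andP[? ?] /andP[? ?]; rewrite !gpredM.
- by move=> x; rewrite !inE !gpredV.
- by move=> x y; rewrite !inE !gpredJE.
Defined.

Lemma mem_meet_subgroup A B x :
  (x \in meet_subgroup A B) = (x \in A) && (x \in B).
Proof. by []. Qed.

Definition preim_subgroup (f : UMagmaMorphism.type G G) A : normalClosed G.
Proof.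
apply: (@pack_normalClosed [pred x | f x \in A]).
- by rewrite inE gmulf1 gpred1.
- by move=> x y; rewrite !inE gmulfM; apply: gpredM.
- by move=> x; rewrite !inE gmulfV gpredV.
- by move=> x y; rewrite !inE gmulfJ gpredJE.
Defined.

Lemma mem_preim_subgroup (f : UMagmaMorphism.type G G) A x :
  (x \in preim_subgroup f A) = (f x \in A).
Proof. by []. Qed.

Lemma finite_preim_subgroup (f : UMagmaMorphism.type G G) A :
  injective f -> finite_set [set` A] -> finite_set [set` preim_subgroup f A].
Proof. by move=> injf; apply: finite_preimage => x y _ _ /injf. Qed.

(** Subgroups are boolean predicates, so the existential is decided classically. *)
Definition prod_subgroup A B : normalClosed G.
Proof.
apply: (@pack_normalClosed [pred x | `[< exists2 a, a \in A & a^-1 * x \in B >]]).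
- by apply/asboolP; exists 1; rewrite ?mulg1 ?invg1 gpred1.
- move=> x y /asboolP[a Aa Bx] /asboolP[b Ab By].
  apply/asboolP; exists (a * b); first exact: gpredM.
  have -> : (a * b)^-1 * (x * y) = (a^-1 * x) ^ b * (b^-1 * y).
    by rewrite /conjg invgM -!mulgA mulVKg.
  by rewrite gpredM ?gpredJE.
- move=> x /asboolP[a Aa Bx]; apply/asboolP.
  exists a^-1; first by rewrite gpredV.
  have -> : a^-1^-1 * x^-1 = ((a^-1 * x)^-1) ^ a^-1.
    by rewrite /conjg invgM !invgK !mulgA mulgK.
  by rewrite gpredJE gpredV.
- move=> x y /asboolP[a Aa Bx]; apply/asboolP.
  by exists (a ^ y); rewrite ?gpredJE// -conjVg -conjMg gpredJE.
Defined.

Lemma prod_subgroupP A B x :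
  reflect (exists2 a, a \in A & a^-1 * x \in B) (x \in prod_subgroup A B).
Proof. exact: asboolP. Qed.

Lemma mem_prod_subgroupl A B x : x \in A -> x \in prod_subgroup A B.
Proof. by move=> Ax; apply/prod_subgroupP; exists x; rewrite ?mulVg ?gpred1. Qed.

Lemma mem_prod_subgroupr A B x : x \in B -> x \in prod_subgroup A B.
Proof.
by move=> Bx; apply/prod_subgroupP; exists 1; rewrite ?gpred1 ?invg1 ?mul1g.
Qed.

Lemma finite_prod_subgroup A B : finite_set [set` A] -> finite_set [set` B] ->
  finite_set [set` prod_subgroup A B].
Proof.
move=> finA finB; apply: sub_finite_set (finite_image2 *%g finA finB).
move=> x /prod_subgroupP[a Aa Bx].
by exists a => //; exists (a^-1 * x); rewrite ?mulVKg.
Qed.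

Definition aut_stable (A : {pred G}) :=
  forall f : UMagmaMorphism.type G G, bijective f ->
  forall x, (f x \in A) = (x \in A).

(** The converse implication comes from the hypothesis applied to the inverse automorphism. *)
Lemma sub_aut_stable (A : {pred G}) :
    (forall f : UMagmaMorphism.type G G, bijective f ->
      forall x, x \in A -> f x \in A) ->
  aut_stable A.
Proof.
move=> subA f bijf x; apply/idP/idP; last exact: subA.
have [g fK gK] := bijf.
pose g' : UMagmaMorphism.type G G := HB.pack g
  (isMultiplicative.Build G G g (can2_gmulfM fK gK))
  (Multiplicative_isUMagmaMorphism.Build G G g (can2_gmulf1 fK gK)).
by move=> /(subA g' (Bijective gK fK))/=; rewrite fK.
Qed.

Lemma aut_stable_characteristic A : aut_stable A -> characteristic A.
Proof.
(* [characteristic] ranges over maps that are only [multiplicative]; cancellation in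
   [f 1 * f 1 = f 1] allows repackaging [f] for [aut_stable]. *)
move=> stA f bijf; have f1 : f 1 = 1.
  by apply: (mulgI (f 1)); rewrite -gmulfM !mulg1.
pose f' : UMagmaMorphism.type G G :=
  HB.pack (f : G -> G) (isMultiplicative.Build G G f gmulfM)
    (Multiplicative_isUMagmaMorphism.Build G G f f1).
have {}stA x : (f x \in A) = (x \in A) by exact: (stA f' bijf).
have [g fK gK] := bijf.
apply/seteqP; split=> [_ [x Ax <-]|x Ax]; first by rewrite /= stA.
by exists (g x); rewrite ?gK//= -stA gK.
Qed.

Lemma aut_stable_trivial_subgroup : aut_stable trivial_subgroup.
Proof. by move=> f /bij_inj injf x; rewrite !mem_trivial_subgroup gmulf_eq1. Qed.

Lemma aut_stable_prod_subgroup A B :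
  aut_stable A -> aut_stable B -> aut_stable (prod_subgroup A B).
Proof.
move=> stA stB; apply: sub_aut_stable => f bijf x /prod_subgroupP[a Aa Bx].
by apply/prod_subgroupP; exists (f a); rewrite ?stA// -gmulfV -gmulfM stB.
Qed.

(* [E] holds of the elements not covered by the arguments that are already
   characteristic. *)
Lemma stabilize_first_arg (E : G -> Prop) (n : nat) (ns : seq nat) A B :
    (forall f : UMagmaMorphism.type G G, bijective f -> forall x, E x -> E (f x)) ->
    finite_set [set` A] -> finite_set [set` B] ->
    (forall x, E x -> x ^+ n \in A \/ exists2 m, m \in ns & x ^+ m \in B) ->
  exists A' B', [/\ aut_stable A', finite_set [set` A'], finite_set [set` B'] &
    forall x, E x -> x ^+ n \in A' \/ exists2 m, m \in ns & x ^+ m \in B'].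
Proof.
move=> stE; have [c] := ubnP #|` fset_set [set` A]|.
elim: c A B => // c IHc A B; rewrite ltnS => leAc finA finB EAB.
have [/sub_aut_stable stA|] := pselect (forall f : UMagmaMorphism.type G G,
  bijective f -> forall x, x \in A -> f x \in A); first by exists A, B.
(* As [f] sends [a] outside [A], the intersection of [A] with its preimage misses [a], and the
   induction on the size of [A] applies to it. *)
move=> /existsNP[f /not_implyP[bijf /existsNP[a /not_implyP[Aa nAfa]]]].
have injf := bij_inj bijf.
have finI : finite_set [set` meet_subgroup A (preim_subgroup f A)].
  by apply: sub_finite_set finA => x /andP[].
apply: (IHc (meet_subgroup A (preim_subgroup f A))
            (prod_subgroup B (preim_subgroup f B))) => //.
- apply: leq_trans leAc; apply/fproper_ltn_card; rewrite fproperE.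
  apply/andP; split; first by rewrite -fset_set_sub// => x /andP[].
  by apply/negP; rewrite -fset_set_sub// => /(_ a Aa)/andP[].
- exact: finite_prod_subgroup (finite_preim_subgroup injf finB).
(* The cover is used at both [x] and [f x]: either both [n]-th powers lie in [A], or some [x ^+ m]
   lies in [B] or in its preimage, hence in the product. *)
move=> x Ex; have [An|[m ns_m Bm]] := EAB x Ex; last first.
  by right; exists m => //; apply: mem_prod_subgroupl.
have [Afn|[m ns_m Bm]] := EAB (f x) (stE f bijf x Ex).
  by left; rewrite mem_meet_subgroup mem_preim_subgroup An gmulfXn.
by right; exists m => //; apply: mem_prod_subgroupr; rewrite mem_preim_subgroup gmulfXn.
Qed.

(** Induction on [ns], with [E] general: each round makes the subgroup for the head exponent stable
    and leaves the tail to the elements it does not cover. *)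
Lemma stabilize_power_cover (E : G -> Prop) (ns : seq nat) A :
    (forall f : UMagmaMorphism.type G G, bijective f -> forall x, E x -> E (f x)) ->
    finite_set [set` A] ->
    (forall x, E x -> exists2 n, n \in ns & x ^+ n \in A) ->
  exists H : normalClosed G, [/\ aut_stable H, finite_set [set` H] &
    forall x, E x -> exists2 n, n \in ns & x ^+ n \in H].
Proof.
elim: ns E A => [|n ns IHns] E A stE finA EA.
  exists trivial_subgroup; split=> [||x /EA[//]].
    exact: aut_stable_trivial_subgroup.
  exact: finite_trivial_subgroup.
have [x Ex|D [K [stD finD finK EDK]]] :=
  @stabilize_first_arg E n ns A A stE finA finA.
  have [m] := EA x Ex; rewrite inE => /predU1P[-> ?|]; first by left.
  by right; exists m.
(* Stability of [D] is what makes [E'] invariant under automorphisms. *)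
pose E' x := E x /\ x ^+ n \notin D.
have [|x [Ex /negPf nDx]|H [stH finH E'H]] := IHns E' K _ finK.
- by move=> f bijf x [Ex nDx]; split; [apply: stE | rewrite -gmulfXn stD].
- by have [|//] := EDK x Ex; rewrite nDx.
exists (prod_subgroup D H); split=> [||x Ex].
- exact: aut_stable_prod_subgroup.
- exact: finite_prod_subgroup.
have [Dn|nDn] := boolP (x ^+ n \in D).
  by exists n; rewrite ?mem_head//; apply: mem_prod_subgroupl.
have [//|m ns_m Hm] := E'H x.
by exists m; [rewrite inE ns_m orbT | apply: mem_prod_subgroupr].
Qed.

Lemma pi_quotg_expg_eq1 A x n :
  ((\pi_(quotg A)%qT x : quotg A) ^+ n = 1) <-> (x ^+ n \in A).
Proof.
rewrite -gmulfXn -(pi_quotg1 A).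
split=> [/esym/eqP|An]; last apply/esym/eqP; rewrite pi_coset_eq /coset_eq;
  by rewrite invg1 mul1g.
Qed.

End NormalSubgroups.

Section Orders.
Set Implicit Arguments.
Unset Strict Implicit.
Local Open Scope group_scope.

Lemma has_order_exists (G : groupType) (x : G) (m : nat) :
  (0 < m)%N -> x ^+ m = 1 -> exists n, has_order x n.
Proof.
move=> m0 xm; have exP : exists n, (0 < n)%N && (x ^+ n == 1).
  by exists m; rewrite m0 xm eqxx.
have [n /andP[n0 /eqP xn] minn] := ex_minnP exP.
by exists n; split=> // k k0 xk; apply: minn; rewrite k0 xk eqxx.
Qed.

(** A nonzero remainder of [m] modulo [n] would be a smaller positive exponent killing [x]. *)
Lemma has_order_dvdn (G : groupType) (x : G) (n m : nat) :
  has_order x n -> x ^+ m = 1 -> (n %| m)%N.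
Proof.
move=> [n0 xn minn] xm; rewrite /dvdn -leqn0 leqNgt; apply/negP => r0.
have := minn _ r0; rewrite leqNgt ltn_mod n0 => /(_ _)/notF; apply.
by move: xm; rewrite {1}(divn_eq m n) expgnDr mulnC expgnA xn expg1n mul1g.
Qed.

(** If [x] has order [k * n], then [x ^+ k] has order [n]. *)
Lemma spectrum_dvdn (G : groupType) (n m : nat) :
  (n %| m)%N -> spectrum G m -> spectrum G n.
Proof.
move=> /dvdnP[k ->] [x [kn0 xkn minkn]]; exists (x ^+ k).
move: kn0; rewrite muln_gt0 => /andP[k0 n0].
split=> // [|j j0 xkj]; first by rewrite -expgnA.
by rewrite -(leq_pmul2l k0) minkn ?muln_gt0 ?k0// expgnA.
Qed.

End Orders.

Theorem mainTheorem5 (G : groupType) (expG : bounded_exponent G)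
    (N : normalClosed G) (finN : finite_set [set` N]) :
  exists H : normalClosed G,
    [/\ characteristic H, finite_set [set` H]
      & spectrum (quotg H) `<=` spectrum (quotg N)].
Proof.
have [m m0 expm] := expG.
(* Every order in the quotient is at most the exponent [m], so this finite list contains the whole
   spectrum. *)
pose ns := [seq n <- iota 0 m.+1 | `[< spectrum (quotg N) n >]].
have Nns x : True -> exists2 n, n \in ns & (x ^+ n)%g \in N.
  have pim : (\pi_(quotg N)%qT x ^+ m = 1 :> quotg N)%g.
    by apply/pi_quotg_expg_eq1; rewrite expm gpred1.
  have [n ordn] := has_order_exists m0 pim.
  have [n0 /pi_quotg_expg_eq1 Nxn minn] := ordn.
  exists n => //; rewrite mem_filter mem_iota leq0n ltnS minn// !andbT.
  by apply/asboolP; exists (\pi_(quotg N)%qT x).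
have [//|H [stH finH Hns]] := stabilize_power_cover _ finN Nns.
exists H; split=> //; first exact: aut_stable_characteristic.
move=> n [y]; rewrite -[y]reprK => ordn.
(* The order [n] of [y] divides some [k] in the spectrum of the quotient by [N]. *)
have [//|k + /pi_quotg_expg_eq1 /(has_order_dvdn ordn) nk] := Hns (repr y).
by rewrite mem_filter => /andP[/asboolP specNk _]; apply: spectrum_dvdn specNk.
Qed.
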